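(* Let $\mathcal D\subset\mathcal H$ be an (F)-domain in a Hilbert space $\mathcal H$ and let $\mathcal A\subset\mathcal L^+(\mathcal D)$ be a $*$-ideal of $\mathcal L^+(\mathcal D)$. For each $1\le j\le n$ let $\tau_j$ denote either the identity on $\mathcal A$ or the adjoint operation $A\mapsto A^+$. Suppose that $\Phi\colon\mathcal A\to\mathcal A$ is a bijective function (no additivity or linearity is assumed) satisfying the identity $$\Phi(\tau_1(T_1)\tau_2(T_2)\cdots\tau_n(T_n))=\tau_1(\Phi(T_1))\,\tau_2(\Phi(T_2))\cdots\tau_n(\Phi(T_n))$$ for all $T_1,T_2,\dots,T_n\in\mathcal A$. If there is an index $j$ such that $\tau_j$ is the adjoint operation, then $\Phi$ is an additive triple automorphism, i.e. $\Phi$ is additive and $$\Phi(AB^+C)=\Phi(A)\Phi(B)^+\Phi(C)\quad\text{for all }A,B,C\in\mathcal A.$$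
   Context: For a dense linear subspace $\mathcal D$ of a complex Hilbert space $\mathcal H$, $\mathcal L^+(\mathcal D)$ denotes the set of all linear operators $A\colon\mathcal D\to\mathcal D$ whose Hilbert space adjoint $A^*$ is defined on $\mathcal D$ and satisfies $A^*\mathcal D\subset\mathcal D$. It is a $*$-algebra with the usual operations and the involution $A\mapsto A^+:=A^*|_{\mathcal D}$. The graph topology $t$ on $\mathcal D$ is the locally convex topology generated by the seminorms $\phi\mapsto\|A\phi\|$, $A\in\mathcal L^+(\mathcal D)$. The dense linear subspace $\mathcal D$ is an (F)-domain if $(\mathcal D,t)$ is an (F)-space, i.e. a Fréchet space (metrizable and complete). A $*$-ideal of $\mathcal L^+(\mathcal D)$ is a two-sided ideal closed under $A\mapsto A^+$.
   Formalization: The formal theorem additionally assumes n ≥ 2 and that the Hilbert space is not one-dimensional; the claim is false otherwise (n = 1: swap T and 2T for a self-adjoint T; dimension one: z ↦ z|z| on the complex numbers). *)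

(* Defs.v *)
From HB Require Import structures.
From mathcomp Require Import all_boot all_order all_algebra.
From mathcomp Require Import all_classical all_reals all_analysis.
From mathcomp Require Import complex sesquilinear.

Set Implicit Arguments.
Unset Strict Implicit.
Unset Printing Implicit Defensive.

Import Order.TTheory GRing.Theory Num.Theory.
Import numFieldNormedType.Exports.

Local Open Scope classical_set_scope.
Local Open Scope ring_scope.

(* Complex Hilbert space: a complete normed module H over R[i] with an inner
   product ip, linear in its first and conjugate-linear in its second argument.
   The compatibility `|x| ^+ 2 = ip x x is left to the theorems, as no
   definition depends on it. *)

Record dom (R : realType) (H : completeNormedModType R[i])
  (D : submodClosed H) : Type := Dom { domval : H; _ : domval \in D }.

Section DomainInstances.
Variables (R : realType) (H : completeNormedModType R[i]).
Variable D : submodClosed H.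

HB.instance Definition _ := [isSub for @domval R H D].
HB.instance Definition _ := [Choice of dom D by <:].
HB.instance Definition _ := [SubChoice_isSubLmodule of dom D by <:].

End DomainInstances.

Definition complete_uniform (T : uniformType) : Prop :=
  forall F : set_system T, ProperFilter F -> cauchy F -> exists x : T, F --> x.

Definition metrizable (R : realType) (T : topologicalType) : Prop :=
  exists d : T -> T -> R,
    [/\ forall x y, d x y = 0 <-> x = y,
        forall x y, d x y = d y x,
        forall x y z, d x z <= d x y + d y z
      & forall x : T, nbhs x =
          filter_from [set e : R | 0 < e] (fun e => [set y | d x y < e])].

Section Operators.
Variables (R : realType) (H : completeNormedModType R[i]).
Variables (ip : {dot H for Num.conj}) (D : submodClosed H).

Definition is_adjoint_value (A : dom D -> dom D) (y z : H) : Prop :=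
  forall x : dom D, ip (\val (A x)) y = ip (\val x) z.

Definition adjoint_dom (A : dom D -> dom D) : set H :=
  [set y | exists z, is_adjoint_value A y z].

(* The value is unique when D is dense; outside adjoint_dom A it is 0. *)
Definition adjoint (A : dom D -> dom D) (y : H) : H :=
  xget 0 [set z | is_adjoint_value A y z].

Definition Lplus : set (dom D -> dom D) :=
  [set A | linear A /\
    forall y : dom D, adjoint_dom A (\val y) /\ adjoint A (\val y) \in D].

(* The involution A^+, i.e. the restriction of the adjoint to D; insubd only
   resorts to its default 0 when A is not in Lplus. *)
Definition involution (A : dom D -> dom D) : dom D -> dom D :=
  fun y => insubd 0 (adjoint A (\val y)).

Record star_ideal (I : set (dom D -> dom D)) : Prop := StarIdeal {
  ideal_sub : I `<=` Lplus;
  ideal0 : I 0;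
  idealD : forall A B, I A -> I B -> I (A + B);
  idealZ : forall (c : R[i]) A, I A -> I (c *: A);
  idealMl : forall A B, Lplus A -> I B -> I (A \o B);
  idealMr : forall A B, I A -> Lplus B -> I (A \o B);
  ideal_plus : forall A, I A -> I (involution A) }.

(* D with its graph topology. The entourages below are those of the locally
   convex topology generated by the seminorms phi |-> `|A phi|, A in Lplus:
   phi has the neighbourhood basis {psi | `|A (phi - psi)| < e for A in S},
   with S a finite subset of Lplus and 0 < e. *)
Definition graph_space : Type := dom D.

HB.instance Definition _ := GRing.Lmodule.on graph_space.

Definition graph_strip (S : set (dom D -> dom D)) (e : R[i]) :
    set (graph_space * graph_space) :=
  [set uv | forall A, S A -> `|\val (A (uv.1 - uv.2))| < e].

Definition graph_ent : set_system (graph_space * graph_space) :=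
  [set E | exists S e, [/\ finite_set S, S `<=` Lplus, 0 < e
    & graph_strip S e `<=` E]].

Lemma Lplus0 A : Lplus A -> A 0 = 0.
Proof. by move=> [/(_ (-1) 0 0)+ _]; rewrite scaler0 addr0 scaleN1r addNr. Qed.

Lemma graph_ent_filter : Filter graph_ent.
Proof.
split.
- by exists set0, 1; split => //; exact: sub0set.
- move=> E F [S [e [finS SL e0 SE]]] [T [f [finT TL f0 TF]]].
  have cef : e >=< f by apply: real_comparable; exact: gtr0_real.
  exists (S `|` T), (Num.min e f); split.
  + by rewrite finite_setU.
  + by rewrite subUset.
  + by rewrite comparable_lt_min // e0 f0.
  + move=> uv st; split.
    * apply: SE => A SA; have := st A (or_introl SA).
      by rewrite comparable_lt_min // => /andP[].
    * apply: TF => A TA; have := st A (or_intror TA).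
      by rewrite comparable_lt_min // => /andP[].
- move=> E F EF [S [e [finS SL e0 SE]]].
  by exists S, e; split => //; exact: subset_trans EF.
Qed.

Lemma graph_ent_diagonal E : graph_ent E -> diagonal `<=` E.
Proof.
move=> [S [e [_ SL e0 SE]]] [u v] /diagonalP ->; apply: SE => A /SL/Lplus0 A0 /=.
by rewrite subrr A0 [\val _]raddf0 normr0.
Qed.

Lemma graph_ent_inv E : graph_ent E -> graph_ent E^-1%relation.
Proof.
move=> [S [e [finS SL e0 SE]]]; exists S, e; split => // -[u v] st.
apply: SE => A SA /=; have [lA _] := SL A SA; have A0 := Lplus0 (SL A SA).
have := st A SA; rewrite /= -(opprB v u).
have -> : - (v - u) = -1 *: (v - u) + 0 by rewrite addr0 scaleN1r.
by rewrite lA A0 addr0 scaleN1r [\val _]raddfN normrN.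
Qed.

Lemma graph_ent_split E : graph_ent E ->
  exists2 F, graph_ent F & (F \; F `<=` E)%relation.
Proof.
move=> [S [e [finS SL e0 SE]]]; exists (graph_strip S (e / 2)).
  by exists S, (e / 2); split => //; rewrite divr_gt0.
move=> [u w] [v /= uv vw]; apply: SE => A SA /=; have [lA _] := SL A SA.
have -> : (u : dom D) - w = 1 *: (u - v) + (v - w).
  by rewrite scale1r addrA subrK.
rewrite lA scale1r [\val _]raddfD /= (le_lt_trans (ler_normD _ _))// (splitr e).
by rewrite ltrD//; [exact: (uv A SA)|exact: (vw A SA)].
Qed.

HB.instance Definition _ := isUniform.Build graph_space
  graph_ent_filter graph_ent_diagonal graph_ent_inv graph_ent_split.

Definition F_domain : Prop :=
  [/\ dense [set x : H | x \in D], metrizable R graph_space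
    & complete_uniform graph_space].

Definition tau (b : bool) (A : dom D -> dom D) : dom D -> dom D :=
  if b then involution A else A.

Definition op_prod (n : nat) (T : 'I_n -> dom D -> dom D) : dom D -> dom D :=
  \big[(fun A B => A \o B)/idfun]_(j < n) T j.

Definition additive_triple_automorphism (I : set (dom D -> dom D))
    (Phi : (dom D -> dom D) -> (dom D -> dom D)) : Prop :=
  [/\ set_bij I I Phi,
      forall A B, I A -> I B -> Phi (A + B) = Phi A + Phi B
    & forall A B C, I A -> I B -> I C ->
        Phi (A \o involution B \o C) = Phi A \o involution (Phi B) \o Phi C].

End Operators.

(* Needed to rule out D = H = C, where z |-> z * `|z| is a non-additive
   multiplicative bijection commuting with conjugation. *)
Definition one_dimensional (K : pzRingType) (V : lmodType K) : Prop :=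
  exists2 e : V, e != 0 & forall x : V, exists c : K, x = c *: e.

(* Main.v *)
Require Import Defs.
From HB Require Import structures.
From mathcomp Require Import all_boot all_order all_algebra.
From mathcomp Require Import all_classical all_reals all_analysis.
From mathcomp Require Import complex sesquilinear.

Set Implicit Arguments.
Unset Strict Implicit.
Unset Printing Implicit Defensive.

Import Order.TTheory GRing.Theory Num.Theory.
Import numFieldNormedType.Exports.

Local Open Scope classical_set_scope.
Local Open Scope ring_scope.

(** As [Phi] is only known to be a bijection respecting one product, all
    information is extracted from the rank-one operators [rank1 x y],
    [z |-> <z, y> x], which every nonzero ideal contains.

    Additivity. When all factors but one are rank one, the product identity says
    [Phi (a X c) = L (a) Phi (X) R (c)] for rank-one [a] and [c], with [L (a)]
    and [R (c)] independent of [X] ([word_map_sandwich]). Since [a X c] is then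
    [<X z, y>] times a rank-one operator, the question whether [S = A + B] when
    [Phi S = Phi A + Phi B] is decided by [Phi] on the multiples of a single
    projection [E11] ([word_map_test]). On these multiples additivity follows
    from the factorisation [(c + d) E11 = (E11 + E12) (c E11 + d E21)], together
    with additivity on the column [c E11 + d E21], whose two entries are
    separated by rank-one operators that kill one of them. This is where a
    second dimension is indispensable.

    The triple identity. [Phi] and its inverse preserve rank one, and
    [Phi (rank1 x y) = rank1 (U x) (V y)] for two maps [U], [V] of the domain.
    A product of rank-one operators is a product of inner products, one for each
    pair of neighbouring factors. Hence the product identity splits into one
    relation [<W x, W' y> = const * sig <x, y>] for each pair of neighbours,
    with [W] and [W'] equal to [U] or [V] according to which of the two factors is
    starred ([link_sig]), and one relation for each end of the word.
    A starred end factor, or two neighbours that are both starred or both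
    unstarred, force [V] to be a multiple of [U]; otherwise stars alternate,
    beginning and ending with an unstarred factor. In both cases
    [<U x, U y> = N_U sig <x, y>] and [<V x, V y> = N_V sig <x, y>] ([gramP]).
    Comparing norms in the product identity for a unit projection gives
    [(N_U N_V)^n = N_U N_V], so [N_U N_V = 1] because these numbers are
    positive. Finally one arbitrary factor [A] next to rank-one factors yields
    [Phi (A) V = N_V U A] and [Phi (A)^+ U = N_U V A^+], and so both sides of
    the triple identity act in the same way on the range of [V], which
    separates points. *)

(** * Operators with an adjoint *)

Section AdjointableOperators.
Variables (C : numClosedFieldType) (E : lmodType C) (br : {dot E for Num.conj}).

Local Notation "''[' u , v ]" := (br u v) : ring_scope.

Lemma ipDl x y z : '[x + y, z] = '[x, z] + '[y, z].
Proof. exact: linearDl. Qed.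

Lemma ipDr x y z : '[x, y + z] = '[x, y] + '[x, z].
Proof. exact: linearDr. Qed.

Lemma ipZl c x y : '[c *: x, y] = c * '[x, y].
Proof. exact: linearZl_LR. Qed.

Lemma ipZr c x y : '[x, c *: y] = c^* * '[x, y].
Proof. exact: linearZr_LR. Qed.

Lemma ipC x y : '[x, y]^* = '[y, x].
Proof. by rewrite [RHS]hermC expr0 mul1r. Qed.

Lemma ip0l x : '[0, x] = 0.
Proof. by rewrite -(scale0r x) ipZl mul0r. Qed.

Lemma ip0r x : '[x, 0] = 0.
Proof. by rewrite -ipC ip0l conjC0. Qed.

Lemma ipBl x y z : '[x - y, z] = '[x, z] - '[y, z].
Proof. by rewrite -scaleN1r ipDl ipZl mulN1r. Qed.

Lemma ipBr x y z : '[x, y - z] = '[x, y] - '[x, z].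
Proof. by rewrite -scaleN1r ipDr ipZr rmorphN1 mulN1r. Qed.

Lemma ip_gt0 x : x != 0 -> 0 < '[x, x].
Proof. exact: neq0_dnorm_gt0. Qed.

Lemma ip_neq0 x : x != 0 -> '[x, x] != 0.
Proof. by move=> /ip_gt0; exact: lt0r_neq0. Qed.

Lemma ip_sepr y : (forall x, '[x, y] = 0) -> y = 0.
Proof.
by move=> y0; apply/eqP; apply: contraT => /ip_neq0; rewrite y0 eqxx.
Qed.

Lemma ip_injr y z : (forall x, '[x, y] = '[x, z]) -> y = z.
Proof. by move=> yz; apply/subr0_eq/ip_sepr => x; rewrite ipBr yz subrr. Qed.

Lemma ip_injl y z : (forall x, '[y, x] = '[z, x]) -> y = z.
Proof. by move=> yz; apply/ip_injr => x; rewrite -ipC yz ipC. Qed.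

Definition adjoint_of (A B : E -> E) := forall x y, '[A x, y] = '[x, B y].

Definition adjointable (A : E -> E) := exists B, adjoint_of A B.

Definition adj (A : E -> E) : E -> E := xget 0 [set B | adjoint_of A B].

Lemma adjoint_of_sym A B : adjoint_of A B -> adjoint_of B A.
Proof. by move=> AB x y; rewrite -ipC -AB ipC. Qed.

Lemma adjoint_of_uniq A B B' : adjoint_of A B -> adjoint_of A B' -> B = B'.
Proof.
by move=> AB AB'; apply/funext => y; apply: ip_injr => x; rewrite -AB AB'.
Qed.

Lemma adjP A : adjointable A -> adjoint_of A (adj A).
Proof. by move=> [B AB]; rewrite /adj; case: xgetP => [? -> //|/(_ B)]. Qed.

Lemma adjE A B : adjoint_of A B -> adj A = B.
Proof. by move=> AB; apply/(adjoint_of_uniq _ AB)/adjP; exists B. Qed.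

Lemma adjointable_adj A : adjointable A -> adjointable (adj A).
Proof. by move=> /adjP/adjoint_of_sym AB; exists A. Qed.

Lemma adjK A : adjointable A -> adj (adj A) = A.
Proof. by move=> /adjP/adjoint_of_sym/adjE. Qed.

Lemma adjoint_of_comp A A' B B' :
  adjoint_of A A' -> adjoint_of B B' -> adjoint_of (A \o B) (B' \o A').
Proof. by move=> AA BB x y; rewrite /= AA BB. Qed.

Lemma adj_comp A B :
  adjointable A -> adjointable B -> adj (A \o B) = adj B \o adj A.
Proof. by move=> /adjP AA /adjP BB; apply/adjE/adjoint_of_comp. Qed.

Lemma adjointable_comp A B :
  adjointable A -> adjointable B -> adjointable (A \o B).
Proof.
by move=> [A' AA] [B' BB]; exists (B' \o A'); exact: adjoint_of_comp.
Qed.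

(** Having an adjoint forces linearity, as the form is nondegenerate. *)
Lemma adjointableD A x y : adjointable A -> A (x + y) = A x + A y.
Proof. by move=> [B AB]; apply: ip_injl => z; rewrite AB !ipDl !AB. Qed.

Lemma adjointableZ A c x : adjointable A -> A (c *: x) = c *: A x.
Proof. by move=> [B AB]; apply: ip_injl => z; rewrite AB !ipZl !AB. Qed.

Lemma adjointable0 A : adjointable A -> A 0 = 0.
Proof. by move=> hA; rewrite -(scale0r 0) adjointableZ// !scale0r. Qed.

Definition star_if (b : bool) (A : E -> E) := if b then adj A else A.

Lemma star_if_adjointable b A : adjointable A -> adjointable (star_if b A).
Proof. by case: b => //=; exact: adjointable_adj. Qed.

Lemma star_ifK b A : adjointable A -> star_if b (star_if b A) = A.
Proof. by case: b => //=; exact: adjK. Qed.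

(** * Rank-one operators *)

Definition rank1 (x y : E) : E -> E := fun z => '[z, y] *: x.

Lemma rank1E x y z : rank1 x y z = '[z, y] *: x.
Proof. by []. Qed.

Lemma scale_rank1E c x y z : (c *: rank1 x y) z = c *: ('[z, y] *: x).
Proof. by []. Qed.

Lemma rank1_adjoint_of x y : adjoint_of (rank1 x y) (rank1 y x).
Proof. by move=> u v; rewrite /rank1 ipZl ipZr ipC mulrC. Qed.

Lemma adj_rank1 x y : adj (rank1 x y) = rank1 y x.
Proof. exact/adjE/rank1_adjoint_of. Qed.

Lemma rank1_adjointable x y : adjointable (rank1 x y).
Proof. by exists (rank1 y x); exact: rank1_adjoint_of. Qed.

Lemma rank1_0l y : rank1 0 y = 0.
Proof. by apply/funext => z; rewrite /rank1 scaler0. Qed.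

Lemma rank1_0r x : rank1 x 0 = 0.
Proof. by apply/funext => z; rewrite /rank1 ip0r scale0r. Qed.

Lemma rank1Zl c x y : rank1 (c *: x) y = c *: rank1 x y.
Proof. by apply/funext => z; rewrite /rank1 scalerA mulrC -scalerA. Qed.

Lemma rank1Zr c x y : rank1 x (c *: y) = c^* *: rank1 x y.
Proof. by apply/funext => z; rewrite /rank1 ipZr -scalerA. Qed.

Lemma comp_rank1 A x y : adjointable A -> A \o rank1 x y = rank1 (A x) y.
Proof. by move=> hA; apply/funext => z; rewrite /= /rank1 adjointableZ. Qed.

Lemma rank1_comp A x y : adjointable A -> rank1 x y \o A = rank1 x (adj A y).
Proof. by move=> hA; apply/funext => z; rewrite /= /rank1 (adjP hA). Qed.

Lemma rank1_sandwich A x y z w : adjointable A ->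
  rank1 x y \o A \o rank1 z w = '[A z, y] *: rank1 x w.
Proof.
move=> hA; rewrite -compA comp_rank1// comp_rank1 ?rank1Zl//.
exact: rank1_adjointable.
Qed.

Lemma rank1_neq0 x y : x != 0 -> y != 0 -> rank1 x y != 0.
Proof.
move=> x0 y0; apply/eqP => /(congr1 (@^~ y)); apply/eqP.
by rewrite /rank1/= scaler_eq0 negb_or ip_neq0.
Qed.

(** Up to the scalar, [<x, x> <y, y>] is the squared norm of [rank1 x y]; here
    it is reached by evaluating both sides at [y] and at [y']. *)
Lemma rank1_eq_norm c x y x' y' : rank1 x y = c *: rank1 x' y' ->
  '[x, x] * '[y, y] = c * c^* * ('[x', x'] * '[y', y']).
Proof.
move=> e.
have h u v : '[u, y] * '[x, v] = c * ('[u, y'] * '[x', v]).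
  by rewrite -!ipZl -/(rank1 x y u) e.
rewrite mulrC h; have /(congr1 Num.conj) := h y' x'.
by rewrite !rmorphM/= !ipC => ->; rewrite [LHS]mulrA ['[x', x'] * _]mulrC.
Qed.

(** * Products of operators *)

Fixpoint word n (f : nat -> E -> E) : E -> E :=
  if n is m.+1 then f 0%N \o word m (fun j => f j.+1) else idfun.

Arguments word n f : simpl never.

Lemma wordS n f : word n.+1 f = f 0%N \o word n (fun j => f j.+1).
Proof. by []. Qed.

Lemma eq_word n f g : (forall j, (j < n)%N -> f j = g j) -> word n f = word n g.
Proof.
elim: n f g => //= n IH f g fg; rewrite !wordS fg//; congr (_ \o _).
by apply: IH => j jn; apply: fg.
Qed.

Lemma word_recr n f : word n.+1 f = word n f \o f n.
Proof. by elim: n f => // n IH f; rewrite wordS IH. Qed.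

Lemma word_adjointable n f :
  (forall j, (j < n)%N -> adjointable (f j)) -> adjointable (word n f).
Proof.
elim: n f => [|n IH] f fn; first by exists idfun.
rewrite wordS; apply: adjointable_comp; first exact: fn.
by apply: IH => j jn; exact: fn.
Qed.

(** In a product of rank-one operators only the outermost vectors survive;
    each pair of neighbours collapses to a number. *)
Lemma word_rank1 m (l r : nat -> E) :
  word m.+1 (fun j => rank1 (l j) (r j)) =
  (\prod_(j < m) '[l j.+1, r j]) *: rank1 (l 0%N) (r m).
Proof.
elim: m l r => [|m IH] l r; first by rewrite big_ord0 scale1r.
have /= IHm := IH (fun j => l j.+1) (fun j => r j.+1).
rewrite wordS IHm -rank1Zl comp_rank1; last exact: rank1_adjointable.
by rewrite rank1E ipZl rank1Zl mulrC big_ord_recl.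
Qed.

End AdjointableOperators.

(** * Ideals containing the rank-one operators *)

Section WordMaps.
Variables (C : numClosedFieldType) (E : lmodType C) (br : {dot E for Num.conj}).

Local Notation "''[' u , v ]" := (br u v) : ring_scope.
Local Notation adjointable := (adjointable br).
Local Notation adj := (adj br).
Local Notation star_if := (star_if br).
Local Notation rank1 := (rank1 br).
Local Notation ip_injl := (@ip_injl _ _ br).
Local Notation ip_injr := (@ip_injr _ _ br).
Local Notation adjointableZ := (@adjointableZ _ _ br).
Local Notation ipDl := (ipDl br).
Local Notation ipDr := (ipDr br).
Local Notation ipZl := (ipZl br).
Local Notation ipZr := (ipZr br).
Local Notation ipBr := (ipBr br).
Local Notation ipC := (ipC br).
Local Notation ip0l := (ip0l br).
Local Notation ip0r := (ip0r br).

Record rank1_ideal (I : set (E -> E)) : Prop := {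
  ideal_adjointable : forall A, I A -> adjointable A;
  ideal_add : forall A B, I A -> I B -> I (A + B);
  ideal_compl : forall A B, adjointable A -> I B -> I (A \o B);
  ideal_compr : forall A B, I A -> adjointable B -> I (A \o B);
  ideal_adj : forall A, I A -> I (adj A);
  ideal_rank1 : forall x y, I (rank1 x y) }.

(** The maps of the theorem, with factors numbered by [nat] so that words can be
    split freely. *)
Record word_map (I : set (E -> E)) (n : nat) (b : nat -> bool)
    (Phi : (E -> E) -> E -> E) : Prop := {
  word_map_bij : set_bij I I Phi;
  word_mapE : forall T, (forall j, I (T j)) ->
    Phi (word n (fun j => star_if (b j) (T j))) =
    word n (fun j => star_if (b j) (Phi (T j))) }.

Variables (I : set (E -> E)) (Iideal : rank1_ideal I).
Let Iadj := ideal_adjointable Iideal.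
Let Irank1 := ideal_rank1 Iideal.
Let Iadd := ideal_add Iideal.

Local Hint Resolve rank1_adjointable star_if_adjointable adjointable_adj : core.

Lemma ideal_star_if b A : I A -> I (star_if b A).
Proof. by case: b => //=; exact: ideal_adj. Qed.

Lemma ideal0_rank1 : I 0.
Proof. by rewrite -(rank1_0l br 0). Qed.

Lemma ideal_word n f : (forall j, I (f j)) -> I (word n.+1 f).
Proof.
by move=> If; rewrite wordS; apply: (ideal_compr Iideal) => //;
  apply: word_adjointable => j _; exact: Iadj.
Qed.

(** The hypothesis is symmetric in [Phi] and its inverse, so that whatever is
    proved for [Phi] in the forward direction also holds backwards. *)
Lemma word_map_inv n b Phi : word_map I n.+1 b Phi -> exists Psi,
  [/\ word_map I n.+1 b Psi, forall X, I X -> Psi (Phi X) = X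
    & forall Y, I Y -> Phi (Psi Y) = Y].
Proof.
move=> [[PhiI inj surj] PhiE].
pose Psi Y : E -> E := xget 0 [set X | I X /\ Phi X = Y].
have PsiP Y : I Y -> I (Psi Y) /\ Phi (Psi Y) = Y.
  move=> /surj[X IX XY]; rewrite /Psi; case: xgetP => [? _ //|/(_ X)].
  by case; split.
have PhiK X : I X -> Psi (Phi X) = X.
  move=> IX; have [IP PP] := PsiP _ (PhiI _ IX).
  by apply: inj => //; rewrite inE.
exists Psi; split => // [|Y /PsiP[]//]; split.
  split=> [Y /PsiP[]//|Y Z|X IX].
    rewrite !inE => /PsiP[_ PY] /PsiP[_ PZ] YZ.
    by rewrite -PY -PZ YZ.
  by exists (Phi X); [exact: PhiI|exact: PhiK].
move=> T IT.
rewrite -[RHS]PhiK; last first.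
  by apply: ideal_word => j; apply: ideal_star_if; case: (PsiP _ (IT j)).
rewrite PhiE; last by move=> j; case: (PsiP _ (IT j)).
by congr (Psi _); apply: eq_word => j _; case: (PsiP _ (IT j)) => _ ->.
Qed.

(** * Additivity *)

Section OneMap.
Variables (m : nat) (b : nat -> bool) (Phi : (E -> E) -> E -> E).
Hypothesis PhiP : word_map I m.+2 b Phi.

Let PhiI : forall X, I X -> I (Phi X).
Proof. by have [[]] := PhiP. Qed.

Let Phi_inj X Y : I X -> I Y -> Phi X = Phi Y -> X = Y.
Proof. by have [[_ inj _] _] := PhiP => ? ?; apply: inj; rewrite inE. Qed.

Let Phi_surj Y : I Y -> exists2 X, I X & Phi X = Y.
Proof. by have [[_ _ surj] _] := PhiP => /surj. Qed.

Let PhiA X : I X -> adjointable (Phi X).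
Proof. by move=> /PhiI/Iadj. Qed.

Lemma word_map0 : Phi 0 = 0.
Proof.
(* Put the preimage of 0 in the first slot and 0 in all others. *)
have [X IX X0] := Phi_surj ideal0_rank1.
have adj0 c : star_if c (0 : E -> E) = 0.
  by case: c => //=; apply: adjE => x y /=; rewrite ip0l ip0r.
pose T j : E -> E := if j == 0%N then X else 0.
have := word_mapE PhiP (T := T); rewrite !wordS /T/= X0 !adj0.
move=> PT; rewrite -[RHS]/(0 \o word m.+1 (fun j => star_if (b j.+1) (Phi 0))).
rewrite -PT => [|j]; last by case: eqP => // _; exact: ideal0_rank1.
congr Phi; apply/funext => x /=; apply/esym/adjointable0.
exact/star_if_adjointable/Iadj.
Qed.

(** Rank-one arguments for which a word of prescribed pattern [c] and length
    [n.+1] has the value [rank1 x w]: the inner vectors are [y] and its multiple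
    normalized by [<y, y>], so that all neighbours contribute the factor 1. *)
Let unit_word (c : nat -> bool) (x y w : E) n j : E -> E :=
  star_if (c j) (rank1 (if j is 0 then x else '[y, y]^-1 *: y)
                       (if j == n then w else y)).

Let word_unit_word c x y w n : y != 0 ->
  word n.+1 (fun j => star_if (c j) (unit_word c x y w n j)) = rank1 x w.
Proof.
move=> y0; rewrite -[RHS]scale1r.
transitivity (word n.+1 (fun j => rank1 (if j is 0 then x else '[y, y]^-1 *: y)
   (if j == n then w else y))).
  by apply: eq_word => j _; rewrite star_ifK.
rewrite (word_rank1 br n (fun j => if j is 0 then x else '[y, y]^-1 *: y)
   (fun j => if j == n then w else y)) eqxx big1// => j _.
by rewrite ltn_eqF// ipZl mulVf// ip_neq0.
Qed.

Let word_map_first : exists R, (forall z w, adjointable (R z w)) /\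
  forall X z w, I X -> z != 0 ->
  Phi (star_if (b 0%N) X \o rank1 z w) = star_if (b 0%N) (Phi X) \o R z w.
Proof.
pose c j := b j.+1.
exists (fun z w =>
  word m.+1 (fun j => star_if (c j) (Phi (unit_word c z z w m j)))).
split=> [z w|X z w IX z0].
  apply: word_adjointable => j _.
  exact/star_if_adjointable/PhiA/ideal_star_if.
pose T j := if j is j.+1 then unit_word c z z w m j else X.
have IT j : I (T j) by case: j => //= j; exact: ideal_star_if.
rewrite -{1}(word_unit_word c z w m z0); exact: (word_mapE PhiP IT).
Qed.

Let word_map_last : exists L, (forall x y, adjointable (L x y)) /\
  forall X x y, I X -> y != 0 ->
  Phi (rank1 x y \o star_if (b m.+1) X) = L x y \o star_if (b m.+1) (Phi X).
Proof.
exists (fun x y =>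
  word m.+1 (fun j => star_if (b j) (Phi (unit_word b x y y m j)))).
split=> [x y|X x y IX y0].
  apply: word_adjointable => j _.
  exact/star_if_adjointable/PhiA/ideal_star_if.
pose T j := if (j < m.+1)%N then unit_word b x y y m j else X.
have TE j : (j < m.+1)%N -> T j = unit_word b x y y m j by rewrite /T => ->.
have IT j : I (T j) by rewrite /T; case: ifP => // _; exact: ideal_star_if.
have TX : T m.+1 = X by rewrite /T ltnn.
have := word_mapE PhiP IT; rewrite !(word_recr m.+1) TX.
rewrite (eq_word (g := fun j => star_if (b j) (unit_word b x y y m j))).
  rewrite word_unit_word// => ->; congr (_ \o _).
  by apply: eq_word => j jm; rewrite TE.
by move=> j jm; rewrite TE.
Qed.

(** The two-sided rule is composed of two one-sided ones. If an end of the word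
    is starred, using that end twice restores [X] and moves the first rank-one
    factor to the other side; otherwise both ends are used once. *)
Lemma word_map_sandwich : exists L R,
  [/\ forall x y, adjointable (L x y), forall z w, adjointable (R z w)
    & forall X x y z w, I X -> y != 0 -> z != 0 ->
      Phi (rank1 x y \o X \o rank1 z w) = L x y \o Phi X \o R z w].
Proof.
have [R [Radj RE]] := word_map_first; have [L [Ladj LE]] := word_map_last.
have IXr X z w : I X -> I (X \o rank1 z w).
  by move=> IX; exact: (ideal_compr Iideal).
have IrX X z w : I X -> I (rank1 z w \o X).
  by move=> IX; exact: (ideal_compl Iideal).
have IS c X : I X -> I (star_if c X) by exact: ideal_star_if.
case: (boolP (b 0%N)) => b0.
  exists (fun x y => adj (R y x)), R; split=> // [x y|X x y z w IX y0 z0].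
    exact/adjointable_adj.
  rewrite b0/= in RE.
  have -> : rank1 x y \o X = adj (adj X \o rank1 y x).
    by rewrite adj_comp ?adj_rank1 ?adjK//; auto.
  rewrite RE//; last by apply: IXr; exact: (IS true).
  rewrite RE// adj_comp ?adjK//; auto.
case: (boolP (b m.+1)) => bm.
  exists L, (fun z w => adj (L w z)); split=> // [x y|X x y z w IX y0 z0].
    exact/adjointable_adj.
  rewrite bm/= in LE.
  have -> : rank1 x y \o X \o rank1 z w = rank1 x y \o adj (rank1 w z \o adj X).
    by rewrite adj_comp ?adj_rank1 ?adjK//; auto.
  rewrite LE//; last by apply: IrX; exact: (IS true).
  rewrite LE// adj_comp ?adjK//; auto.
exists L, R; split=> // X x y z w IX y0 z0.
rewrite (negPf b0) (negPf bm)/= in LE RE.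
by rewrite -compA LE ?RE//; exact: IXr.
Qed.

(** Equations between values of [Phi] can be tested entry by entry, on the
    multiples of one rank-one operator. *)
Lemma word_map_test e S A B y z : I S -> I A -> I B -> Phi S = Phi A + Phi B ->
  Phi ('[S z, y] *: rank1 e e) =
  Phi ('[A z, y] *: rank1 e e) + Phi ('[B z, y] *: rank1 e e).
Proof.
move=> IS IA IB SAB.
have [->|y0] := eqVneq y 0; first by rewrite !ip0r !scale0r word_map0 addr0.
have [->|z0] := eqVneq z 0.
  rewrite (adjointable0 (Iadj IS)) (adjointable0 (Iadj IA)).
  by rewrite (adjointable0 (Iadj IB)) ip0l scale0r word_map0 addr0.
have [L [R [Ladj Radj LR]]] := word_map_sandwich.
rewrite -!(rank1_sandwich (br := br))//; try exact: Iadj.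
rewrite !LR// SAB; apply/funext => x /=.
exact: adjointableD.
Qed.

Section Additivity.
Variables e f : E.
Hypotheses (e1 : '[e, e] = 1) (f1 : '[f, f] = 1) (ef : '[e, f] = 0).

Let fe : '[f, e] = 0.
Proof. by rewrite -ipC ef conjC0. Qed.

Let Iscaled c x y : I (c *: rank1 x y).
Proof. by rewrite -rank1Zl. Qed.

Let scaled_inj c d : Phi (c *: rank1 e e) = Phi (d *: rank1 e e) -> c = d.
Proof.
move=> /(Phi_inj (Iscaled _ _ _) (Iscaled _ _ _))/(congr1 (fun A => '[A e, e])).
by rewrite /= !scale_rank1E !ipZl e1 !mulr1.
Qed.

(** A functional orthogonal to [e] or to [f] sees at most one of the two
    summands, and for it the entrywise test reduces to the injectivity of
    [Phi]. *)
Lemma word_map_column c d :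
  Phi (c *: rank1 e e + d *: rank1 f e) =
  Phi (c *: rank1 e e) + Phi (d *: rank1 f e).
Proof.
set A := c *: _; set B := d *: _.
have IA : I A by exact: Iscaled. have IB : I B by exact: Iscaled.
have [S IS SAB] := Phi_surj (Iadd (PhiI IA) (PhiI IB)).
rewrite -SAB; congr Phi; apply/esym/funext => z; apply: ip_injl => y.
have test := word_map_test e _ z IS IA IB SAB.
have testA u : '[B z, u] = 0 -> '[S z, u] = '[A z, u].
  by move=> B0; apply: scaled_inj; rewrite test B0 scale0r word_map0 addr0.
have testB u : '[A z, u] = 0 -> '[S z, u] = '[B z, u].
  by move=> A0; apply: scaled_inj; rewrite test A0 scale0r word_map0 add0r.
have AE u : '[A z, u] = c * '[z, e] * '[e, u].
  by rewrite /A scale_rank1E !ipZl mulrA.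
have BE u : '[B z, u] = d * '[z, e] * '[f, u].
  by rewrite /B scale_rank1E !ipZl mulrA.
have [y0 [ey0 fy0 ->]] : exists y0, [/\ '[e, y0] = 0, '[f, y0] = 0
    & y = y0 + ('[y, e] *: e + '[y, f] *: f)].
  exists (y - ('[y, e] *: e + '[y, f] *: f)); split; last by rewrite subrK.
    by rewrite ipBr ipDr !ipZr e1 ef mulr1 mulr0 addr0 ipC subrr.
  by rewrite ipBr ipDr !ipZr f1 fe mulr1 mulr0 add0r ipC subrr.
rewrite -[(A + B) z]/(A z + B z) !ipDr !ipZr !ipDl.
rewrite (testA e) ?BE ?fe ?mulr0// (testB f) ?AE ?ef ?mulr0//.
by rewrite (testA y0) ?BE ?AE ?ey0 ?fy0 ?mulr0// !addr0 !add0r.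
Qed.

(** The entry of the column at [e + f] is the sum of its two coefficients. *)
Lemma word_map_scaled_additive c d :
  Phi ((c + d) *: rank1 e e) = Phi (c *: rank1 e e) + Phi (d *: rank1 e e).
Proof.
have := word_map_test e (e + f) e _ _ _ (word_map_column c d).
have -> : (c *: rank1 e e + d *: rank1 f e) e = c *: e + d *: f.
  by rewrite addrfctE !scale_rank1E e1 !scale1r.
rewrite !scale_rank1E e1 !scale1r ipDl !ipZl !ipDr e1 ef f1 fe.
rewrite !addr0 !add0r !mulr1.
by apply => //; exact: Iadd.
Qed.

Lemma word_map_additive A B : I A -> I B -> Phi (A + B) = Phi A + Phi B.
Proof.
move=> IA IB; have [S IS SAB] := Phi_surj (Iadd (PhiI IA) (PhiI IB)).
rewrite -SAB; congr Phi; apply/esym/funext => z; apply: ip_injl => y.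
apply: scaled_inj; rewrite (word_map_test e y z IS IA IB SAB).
by rewrite -word_map_scaled_additive ipDl.
Qed.

End Additivity.

(** * The maps implementing Phi on rank-one operators *)

Let Phi_neq0 X : I X -> X != 0 -> Phi X != 0.
Proof.
move=> IX; apply: contraNN => /eqP X0; apply/eqP/Phi_inj => //.
  exact: ideal0_rank1.
by rewrite word_map0.
Qed.

(** It suffices to find one nonzero multiple of the projection on [e] with an
    image of rank one, as it generates all rank-one operators by two-sided
    products. The sandwich rule yields it from the preimage [X] of an operator
    [rank1 u v] that is not killed by the two outer factors. *)
Lemma word_map_rank1 (e x y : E) : e != 0 ->
  exists u v, Phi (rank1 x y) = rank1 u v.
Proof.
move=> e0; have [L [R [Ladj Radj LR]]] := word_map_sandwich.
pose p := rank1 e e; have Ip : I p by exact: Irank1.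
have ppp : p \o p \o p = '[e, e] ^+ 2 *: p.
  by rewrite /p rank1_sandwich// rank1E ipZl expr2.
have Ippp : I (p \o p \o p) by rewrite ppp -rank1Zl.
have : Phi (p \o p \o p) != 0.
  apply: Phi_neq0 => //.
  by rewrite ppp scaler_eq0 expf_eq0 negb_or rank1_neq0// ip_neq0.
rewrite LR// => Np.
have [u u0] : exists u, L e e u != 0.
  apply: contrapT => /forallNP u0; case/negP: Np; apply/eqP/funext => z /=.
  by apply/eqP/negPn/negP/u0.
have [v v0] : exists v, adj (R e e) v != 0.
  apply: contrapT => /forallNP v0; case/negP: Np; apply/eqP/funext => z /=.
  have -> : R e e z = 0.
    apply: ip_injl => t; rewrite (adjP (Radj e e)) ip0l.
    by have /negP/negPn/eqP -> := v0 t; rewrite ip0r.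
  by rewrite (adjointable0 (PhiA Ip)) (adjointable0 (Ladj _ _)).
have [X IX XE] := Phi_surj (Irank1 u v).
have Xp : Phi ('[X e, e] *: p) = rank1 (L e e u) (adj (R e e) v).
  rewrite -(rank1_sandwich (br := br)); last exact: Iadj.
  by rewrite LR// XE comp_rank1// rank1_comp.
have c0 : '[X e, e] != 0.
  apply/eqP => c0; have := rank1_neq0 br u0 v0.
  by rewrite -Xp c0 scale0r word_map0 eqxx.
have -> : rank1 x y =
    rank1 (('[X e, e] * '[e, e] ^+ 2)^-1 *: x) e \o
    ('[X e, e] *: p) \o rank1 e y.
  rewrite -rank1Zl rank1_sandwich// rank1E ipZl ipZl rank1Zl scalerA.
  by rewrite mulrCA -expr2 mulfV ?scale1r// mulf_neq0// expf_neq0// ip_neq0.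
rewrite LR// -?rank1Zl// rank1Zl Xp comp_rank1// rank1_comp//.
by eexists; eexists.
Qed.

(** In [rank1 x y = rank1 x e \o rank1 e e \o rank1 e y] the left factor
    involves [x] only and the right one [y] only. *)
Lemma word_map_rank1_factor e : '[e, e] = 1 ->
  exists U V, forall x y, Phi (rank1 x y) = rank1 (U x) (V y).
Proof.
move=> e1; have e0 : e != 0.
  by apply: contra_eq_neq e1 => ->; rewrite ip0l eq_sym oner_neq0.
have [u [v uv]] := word_map_rank1 e e e0.
have [L [R [Ladj Radj LR]]] := word_map_sandwich.
exists (fun x => L x e u), (fun y => adj (R e y) v) => x y.
have -> : rank1 x y = rank1 x e \o rank1 e e \o rank1 e y.
  by rewrite rank1_sandwich// rank1E e1 scale1r e1 scale1r.
by rewrite LR// uv comp_rank1// rank1_comp.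
Qed.

End OneMap.

Section ImplementingMaps.
Variables (m : nat) (b : nat -> bool) (Phi : (E -> E) -> E -> E).
Hypothesis PhiP : word_map I m.+2 b Phi.
Variable e : E.
Hypothesis e1 : '[e, e] = 1.
Variables U V : E -> E.
Hypothesis PhiUV : forall x y, Phi (rank1 x y) = rank1 (U x) (V y).

Let e_neq0 : e != 0.
Proof. by apply: contra_eq_neq e1 => ->; rewrite ip0l eq_sym oner_neq0. Qed.

Let PhiI X : I X -> I (Phi X).
Proof. by have [[+ _ _] _] := PhiP; apply. Qed.

Let PhiA X : I X -> adjointable (Phi X).
Proof. by move=> /PhiI/Iadj. Qed.

(** A starred rank-one factor exchanges its two vectors: the left vector of
    factor [j] is carried by [W (b j)] and the right one by [W (~~ b j)]. *)
Let W (c : bool) := if c then V else U.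

(** Rank-one preservation for the inverse of [Phi]: up to scalars, every vector
    is in the range of [U] and in that of [V]. *)
Lemma rank1_onto x y : exists x' y', rank1 x y = rank1 (U x') (V y').
Proof.
have [Psi [PsiP _ PhiK]] := word_map_inv PhiP.
have [x' [y' xy]] := word_map_rank1 PsiP x y e_neq0.
by exists x', y'; rewrite -PhiUV -xy PhiK.
Qed.

Let W_neq0 c x : x != 0 -> W c x != 0.
Proof.
move=> x0; apply/eqP => W0.
suff : Phi (if c then rank1 e x else rank1 x e) = Phi 0.
  have [[_ inj _] _] := PhiP; move=> /inj; rewrite !inE => h.
  have I0 := ideal0_rank1.
  by have := rank1_neq0 br x0 e_neq0; have := rank1_neq0 br e_neq0 x0;
     case: c W0 h => W0 -> //; rewrite ?eqxx.
by rewrite (word_map0 PhiP); case: c W0 => /= W0;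
  rewrite PhiUV W0 ?rank1_0l ?rank1_0r.
Qed.

Let W_sep c z : (forall x, '[W c x, z] = 0) -> z = 0.
Proof.
move=> Wz; apply/eqP; apply: contraT => z0; have [x [y zz]] := rank1_onto z z.
have /eqP := ip_neq0 br z0; case.
have /eqP : '[z, z] * '[z, z] = 0.
  rewrite -ipZl -(rank1E br) zz rank1E ipZl.
  case: c Wz => Wz; last by rewrite (Wz x) mulr0.
  by rewrite -ipC (Wz y) conjC0 mul0r.
by rewrite mulf_eq0 orbb => /eqP.
Qed.

(** The transformation of scalars attached to [Phi]; being a ratio of values of
    [V], it does not depend on the vector that is scaled. *)
Let sig c := '[V e, V (c^* *: e)] / '[V e, V e].

Let UZ c x : U (c *: x) = sig c *: U x.
Proof.
have : rank1 (U (c *: x)) (V e) = rank1 (U x) (V (c^* *: e)).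
  by rewrite -!PhiUV rank1Zl rank1Zr conjCK.
move=> /(congr1 (fun A => A (V e))); rewrite !rank1E.
move=> /(congr1 (fun u => '[V e, V e]^-1 *: u)); rewrite !scalerA mulVf.
  by rewrite scale1r => ->; rewrite mulrC.
exact/ip_neq0/(W_neq0 true).
Qed.

Let sig1 : sig 1 = 1.
Proof. by rewrite /sig conjC1 scale1r divff//; exact/ip_neq0/(W_neq0 true). Qed.

Let PhiZ c x y : Phi (c *: rank1 x y) = sig c *: rank1 (U x) (V y).
Proof. by rewrite -rank1Zl PhiUV UZ rank1Zl. Qed.

(** The contribution of the factors [j] and [j.+1] to the product of the images
    of rank-one operators. *)
Let link j x y := '[W (b j.+1) x, W (~~ b j) y].

Let word_map_links (l r : nat -> E) :
  sig (\prod_(j < m.+1) '[l j.+1, r j]) *: rank1 (U (l 0%N)) (V (r m.+1)) =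
  (\prod_(j < m.+1) link j (l j.+1) (r j)) *:
    rank1 (W (b 0%N) (l 0%N)) (W (~~ b m.+1) (r m.+1)).
Proof.
rewrite -PhiZ -word_rank1.
have := word_mapE PhiP (T := fun j => star_if (b j) (rank1 (l j) (r j))).
rewrite (eq_word (g := fun j => rank1 (l j) (r j))); last first.
  by move=> j _; rewrite star_ifK.
move=> ->; last by move=> j; exact: ideal_star_if.
rewrite /link -(word_rank1 br _ (fun j => W (b j) (l j))
  (fun j => W (~~ b j) (r j))).
by apply: eq_word => j _; case: (b j); rewrite /= ?adj_rank1 PhiUV ?adj_rank1.
Qed.

Let K := \prod_(j < m.+1) link j e e.

Let linksE : rank1 (U e) (V e) = K *: rank1 (W (b 0%N) e) (W (~~ b m.+1) e).
Proof.
have := word_map_links (fun=> e) (fun=> e).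
by rewrite big1 ?sig1 ?scale1r// => j _.
Qed.

(** All vectors not adjacent to the link [j] are kept equal to [e]; dividing by
    the instance where the remaining two are [e] as well isolates the link. *)
Let link_sig j x y : (j < m.+1)%N -> link j x y = link j e e * sig '[x, y].
Proof.
move=> jm; have := word_map_links (fun i => if i == j.+1 then x else e)
  (fun i => if i == j then y else e).
rewrite (bigD1 (Ordinal jm))//= !eqxx big1 => [|i ij]; last first.
  by rewrite eqSS !ifN_eq.
rewrite (bigD1 (Ordinal jm))//= !eqxx.
rewrite (eq_bigr (fun i : 'I_ _ => link i e e)); last first.
  by move=> i ij; rewrite eqSS !ifN_eq.
rewrite mulr1 gtn_eqF//.
have := linksE; rewrite /K (bigD1 (Ordinal jm))//=.
set P := \prod_(i < _ | _) _ => UV eq.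
have : link j e e * sig '[x, y] *: rank1 (U e) (V e) =
    link j x y *: rank1 (U e) (V e).
  by rewrite [in RHS]UV -scalerA eq !scalerA mulrCA.
move=> /eqP; rewrite -subr_eq0 -scalerBl scaler_eq0 orbC.
rewrite (negPf (rank1_neq0 br (W_neq0 false e_neq0) (W_neq0 true e_neq0)))/=.
by rewrite subr_eq0 => /eqP.
Qed.

Let collinear := exists2 k, k != 0 & forall x, V x = k *: U x.

Let collinear_of c d : c != 0 -> (forall x, c *: V x = d *: U x) -> collinear.
Proof.
move=> c0 cd; have VE x : V x = (c^-1 * d) *: U x.
  by rewrite -scalerA -cd scalerA mulVf ?scale1r.
exists (c^-1 * d) => //; apply: contraNneq (W_neq0 true e_neq0) => k0.
by rewrite /= VE k0 scale0r.
Qed.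

(** If the first factor is starred, its left vector is carried by [V] in the
    word and by [U] in the image of the product. *)
Let collinear_first : b 0%N -> collinear.
Proof.
move=> b0; pose c := K * '[V e, W (~~ b m.+1) e].
have UE x : '[V e, V e] *: U x = c *: V x.
  have := word_map_links (fun j => if j is 0 then x else e) (fun=> e).
  rewrite big1 => [|j _]; last by rewrite e1.
  rewrite sig1 scale1r b0 => /(congr1 (fun A => A (V e))).
  by rewrite scale_rank1E rank1E scalerA.
apply: (@collinear_of c '[V e, V e]) => //.
apply: contraNneq (W_neq0 false e_neq0) => c0; have := UE e.
rewrite c0 scale0r => /eqP; rewrite scaler_eq0 (negPf (ip_neq0 _ _))//.
exact: (W_neq0 true).
Qed.

Let collinear_last : b m.+1 -> collinear.
Proof.
move=> bm; apply: (@collinear_of '[U e, U e] (K^* * '[U e, W (b 0%N) e])).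
  exact/ip_neq0/(W_neq0 false).
move=> y.
have := word_map_links (fun=> e) (fun j => if j == m.+1 then y else e).
rewrite big1 => [|j _]; last by rewrite ltn_eqF// e1.
rewrite eqxx sig1 scale1r bm.
rewrite (eq_bigr (fun j : 'I_ _ => link j e e)); last first.
  by move=> j _; rewrite ltn_eqF.
rewrite -/K -rank1Zl => /(congr1 (fun A => adj A (U e))); rewrite !adj_rank1.
by rewrite !rank1E ipZr.
Qed.

(** [W c] multiplies inner products by a constant, up to [sig]. *)
Let gram c := forall x y, '[W c x, W c y] = '[W c e, W c e] * sig '[x, y].

(** Between an unstarred and a starred factor the link involves the same map on
    both sides. *)
Let gram_switch j : (j < m.+1)%N -> b j.+1 = ~~ b j -> gram (b j.+1).
Proof. by move=> jm bj x y; have := link_sig x y jm; rewrite /link -bj. Qed.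

Let collinear_gram c : collinear -> gram c.
Proof.
move=> [k k0 VU].
have WU d x : W d x = (if d then k else 1) *: U x.
  by case: d; rewrite ?scale1r// VU.
have k0' (d : bool) : (if d then k else 1) != 0 by case: d; rewrite ?oner_eq0.
suff UU x y : '[U x, U y] = '[U e, U e] * sig '[x, y].
  by move=> x y; rewrite !WU !ipZl !ipZr (UU x y) !mulrA.
have := link_sig x y (ltn0Sn m); rewrite /link !WU !ipZl !ipZr -!mulrA.
by move=> /(mulfI (k0' _))/mulfI; apply; rewrite conjC_eq0.
Qed.

(** If [W (~~ c)] pairs with [W c] as [W c] does with itself, up to a constant,
    the two maps are proportional, since the range of [W c] separates points. *)
Let collinear_mixed c d : gram c ->
  (forall x y, '[W c x, W (~~ c) y] = d * sig '[x, y]) -> collinear.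
Proof.
move=> gc mixed; pose N := '[W c e, W c e].
have N0 : N != 0 by exact/ip_neq0/W_neq0.
have WE y : N^* *: W (~~ c) y = d^* *: W c y.
  apply/subr0_eq/(W_sep (c := c)) => x.
  by rewrite ipBr !ipZr !conjCK mixed gc -/N mulrCA subrr.
case: c gc mixed @N N0 WE => gc mixed N N0 WE; last first.
  by apply: collinear_of WE; rewrite conjC_eq0.
apply: (@collinear_of d^* N^*) => //.
apply: contraNneq (W_neq0 false e_neq0) => d0; have := WE e.
rewrite d0 scale0r => /eqP; rewrite scaler_eq0 conjC_eq0 (negPf N0)//.
Qed.

Hypothesis b_star : exists2 j, (j < m.+2)%N & b j.

Let switch (a : nat -> bool) n c : a 0%N = c -> a n = ~~ c ->
  exists2 j, (j < n)%N & a j = c /\ a j.+1 = ~~ c.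
Proof.
move=> a0; elim: n => [|n IH] an; first by move: an; rewrite a0; case: (c).
have [an'|an'] := eqVneq (a n) c; first by exists n.
have [|j jn [aj aj1]] := IH; first by move: an'; case: (a n) (c) => [] [].
by exists j => //; exact: leqW.
Qed.

(** All other patterns force [U] and [V] to be proportional. *)
Let alternating := b 0%N = false /\ forall j, (j < m.+1)%N -> b j.+1 = ~~ b j.

(** With unstarred ends, the starred factor provides a switch to starred on its
    left, which controls [V], and a switch back on its right, which controls
    [U]. *)
Let gramP c : gram c.
Proof.
have [b0|/negbTE b0] := boolP (b 0%N).
  exact/collinear_gram/collinear_first.
have [bm|/negbTE bm] := boolP (b m.+1).
  exact/collinear_gram/collinear_last.
have [j jm bj] := b_star; rewrite ltnS in jm.
case: c.
  have [i ij [bi bi1]] := switch (n := j) b0 bj.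
  have := gram_switch (leq_trans ij jm); rewrite bi bi1; exact.
have [||i ij [bi bi1]] := @switch (fun i => b (j + i)%N) (m.+1 - j) true.
- by rewrite addn0.
- by rewrite subnKC// ltnW.
have ji : (j + i < m.+1)%N by rewrite -ltn_subRL.
rewrite addnS in bi1; have := gram_switch ji; rewrite bi bi1; exact.
Qed.

Let alternating_or_collinear : alternating \/ collinear.
Proof.
have [b0|/negbTE b0] := boolP (b 0%N); first by right; exact: collinear_first.
have [alt|] := pselect (forall j, (j < m.+1)%N -> b j.+1 = ~~ b j).
  by left.
move=> /existsNP[j /not_implyP[jm bj]]; right.
have {}bj : b j.+1 = b j by move: bj; case: (b j) (b j.+1) => [] [].
apply: (collinear_mixed (c := b j) (gramP _)) => x y.
by have := link_sig x y jm; rewrite /link bj; exact.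
Qed.

(** * The triple identity *)

Let N c := '[W c e, W c e].

Let N_gt0 c : 0 < N c.
Proof. exact/ip_gt0/W_neq0. Qed.

Let N_conj c : (N c)^* = N c.
Proof. exact: ipC. Qed.

(** Equality in the Cauchy-Schwarz inequality: the two vectors of a link at [e]
    are equal for alternating stars, and otherwise proportional to [U e]. *)
Let link_norm j : (j < m.+1)%N ->
  link j e e * (link j e e)^* = N (b j.+1) * N (~~ b j).
Proof.
move=> jm; case: alternating_or_collinear => [[_ /(_ j jm) bj]|[k _ VU]].
  by rewrite /link bj -/(N _) N_conj.
have WU d x : W d x = (if d then k else 1) *: U x.
  by case: d; rewrite ?scale1r// VU.
rewrite /link /N !WU !ipZl !ipZr !rmorphM/= conjCK ipC.
set x := if _ then _ else _; set y := if _ then _ else _.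
rewrite -[LHS]mulrA -[RHS]mulrA; congr (_ * _).
rewrite [y * (_ * _)]mulrCA mulrACA [RHS]mulrACA; congr (_ * _).
by rewrite mulrC.
Qed.

(** Each of the [m.+2] factors of the word contributes [N false * N true] to the
    squared norm of the product, whose total is [N false * N true]. *)
Let N_mul : N false * N true = 1.
Proof.
have := rank1_eq_norm linksE; rewrite -/(N _) -/(N false) -/(N true).
rewrite /K rmorph_prod -big_split/=.
rewrite (eq_bigr _ (fun i _ => link_norm (ltn_ord i))).
rewrite big_split/= mulrACA.
rewrite [_ * N (b 0%N)]mulrC -(big_ord_recl m.+1 (fun j => N (b j))).
rewrite -(big_ord_recr m.+1 (fun j => N (~~ b j)))/= -big_split/=.
rewrite (eq_bigr (fun=> N false * N true)); last first.
  by move=> j _; case: (b j) => //=; rewrite mulrC.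
rewrite prodr_const card_ord => tE.
have t0 : 0 < N false * N true by rewrite mulr_gt0.
apply/eqP; rewrite -(@pexpr_eq1 _ _ m.+1)// ?ltW//; apply/eqP.
by apply: (mulfI (lt0r_neq0 t0)); rewrite mulr1 -exprS.
Qed.

(** An arbitrary operator in the first slot, followed by rank-one operators
    whose product is [rank1 r e]; only the vector [r] is varied. *)
Let word_map_left : exists k, forall A r, I A ->
  star_if (b 0%N) (Phi A) (W (b 1%N) r) = k *: U (star_if (b 0%N) A r).
Proof.
pose l r j := if j is 0 then r else e.
pose c := \prod_(j < m) '[W (b j.+2) e, W (~~ b j.+1) e] *
  '[V e, W (~~ b m.+1) e].
have UA A r : I A ->
    '[V e, V e] *: U (star_if (b 0%N) A r) =
    c *: star_if (b 0%N) (Phi A) (W (b 1%N) r).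
  move=> IA.
  pose T j := if j is i.+1 then star_if (b j) (rank1 (l r i) e) else A.
  have IT j : I (T j) by case: j => //= j; exact: ideal_star_if.
  have := word_mapE PhiP IT; rewrite !(wordS m.+1).
  pose r' (_ : nat) := e.
  rewrite (eq_word (g := fun j => rank1 (l r j) (r' j))); last first.
    by move=> j _; rewrite star_ifK.
  rewrite word_rank1 big1 ?scale1r => [|j _]; last by rewrite e1.
  rewrite comp_rank1 ?PhiUV; last exact/star_if_adjointable/Iadj.
  pose lW j := W (b j.+1) (l r j); pose rW j := W (~~ b j.+1) (r' j).
  rewrite (eq_word (g := fun j => rank1 (lW j) (rW j))); last first.
    move=> j _; rewrite /= /lW /rW.
    by case: (b j.+1); rewrite /= ?adj_rank1 PhiUV ?adj_rank1.
  rewrite word_rank1.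
  rewrite -rank1Zl comp_rank1; last exact/star_if_adjointable/PhiA.
  move=> /(congr1 (fun A => A (V e))); rewrite !rank1E => ->.
  rewrite adjointableZ; last exact/star_if_adjointable/PhiA.
  by rewrite scalerA mulrC.
have c0 : c != 0.
  apply: contraNneq (W_neq0 false e_neq0) => c0.
  have := UA _ e (Irank1 e e); rewrite c0 scale0r => /eqP.
  rewrite scaler_eq0 (negPf (ip_neq0 _ (W_neq0 true _)))//=.
  by case: (b 0%N); rewrite /= ?adj_rank1 rank1E e1 scale1r.
exists (c^-1 * '[V e, V e]) => A r IA.
by rewrite -scalerA UA// scalerA mulVf// scale1r.
Qed.

(** The first slot determines [Phi A] on the range of [W (b 1)], or its adjoint
    if that slot is starred. Either these are the right ranges because stars
    alternate, or [U] and [V] are proportional. The constant is found from the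
    case where [A] is the projection on [e]. *)
Let pairing A r s : I A -> '[Phi A (V r), U s] = sig '[A r, s].
Proof.
suff [k kP] : exists k, forall A r s,
    I A -> '[Phi A (V r), U s] = k * sig '[A r, s].
  move=> IA; rewrite kP//; have := kP _ e e (Irank1 e e).
  rewrite PhiUV !rank1E !e1 scale1r e1 sig1 mulr1 ipZl.
  rewrite -/(N true) -/(N false) [N true * _]mulrC N_mul => <-.
  by rewrite mul1r.
have [k kP] := word_map_left.
case: alternating_or_collinear => [[b0 /(_ 0%N isT) b1]|[d d0 VU]].
  exists (k * N false) => {}A {}r {}s IA; have := kP A r IA.
  by rewrite b1 b0/= => ->; rewrite ipZl (gramP false) mulrA.
pose d' := if b 1%N then d else 1.
have d'0 : d' != 0 by rewrite /d'; case: ifP; rewrite ?oner_eq0.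
have WU x : U x = d'^-1 *: W (b 1%N) x.
  by rewrite /d'; case: (b 1%N); rewrite /= ?VU ?scalerA ?mulVf ?invr1 ?scale1r.
case: (b 0%N) kP => /= kP.
  exists (d * (d'^-1 * k)^* * N false) => {}A {}r {}s IA.
  rewrite (adjP (PhiA IA)) WU adjointableZ; last exact/adjointable_adj/PhiA.
  rewrite kP// VU scalerA ipZl ipZr (gramP false) (adjP (Iadj IA)).
  by rewrite !mulrA.
exists (d * d'^-1 * k * N false) => {}A {}r {}s IA.
rewrite VU [U r]WU scalerA adjointableZ; last exact: PhiA.
by rewrite kP// scalerA ipZl (gramP false) !mulrA.
Qed.

(** The range of [U] separates points, so the pairing determines the values of
    [Phi A] on the range of [V]. *)
Let Phi_V A r : I A -> Phi A (V r) = N true *: U (A r).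
Proof.
move=> IA; apply/subr0_eq/(W_sep (c := false)) => s.
rewrite -ipC ipBl; apply/eqP; rewrite conjC_eq0 subr_eq0; apply/eqP.
rewrite pairing// ipZl (gramP false) mulrA -/(N false).
by rewrite [N true * _]mulrC N_mul mul1r.
Qed.

Let Phi_adj_U A s : I A -> adj (Phi A) (U s) = N false *: V (adj A s).
Proof.
move=> IA; apply/subr0_eq/(W_sep (c := true)) => r.
rewrite ipBr -(adjP (PhiA IA)) pairing// ipZr (gramP true) (adjP (Iadj IA)).
by rewrite N_conj mulrA -/(N true) N_mul mul1r subrr.
Qed.

Lemma word_map_triple A B D : I A -> I B -> I D ->
  Phi (A \o adj B \o D) = Phi A \o adj (Phi B) \o Phi D.
Proof.
move=> IA IB ID.
have IX : I (A \o adj B \o D).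
  by apply: (ideal_compl Iideal) => //; apply: adjointable_comp;
    [exact: Iadj|exact/adjointable_adj/Iadj].
have aY : adjointable (Phi A \o adj (Phi B) \o Phi D).
  have aAB := adjointable_comp (PhiA IA) (adjointable_adj (PhiA IB)).
  exact: adjointable_comp aAB (PhiA ID).
rewrite -(adjK (PhiA IX)) -(adjK aY); congr adj; apply/funext => z.
apply/subr0_eq/(W_sep (c := true)) => r.
rewrite ipBr -(adjP (PhiA IX)) -(adjP aY) Phi_V//= Phi_V//.
rewrite adjointableZ; last exact/adjointable_adj/PhiA.
rewrite Phi_adj_U// scalerA [N true * _]mulrC N_mul scale1r Phi_V//.
by rewrite subrr.
Qed.

End ImplementingMaps.
End WordMaps.

(** * Inner products on a dense domain *)

Section OrthonormalPairs.
Variables (C : numClosedFieldType) (E : lmodType C) (br : {dot E for Num.conj}).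

Local Notation "''[' u , v ]" := (br u v) : ring_scope.

Lemma normalize (x : E) :
  x != 0 -> exists2 c : C, c != 0 & '[c *: x, c *: x] = 1.
Proof.
move=> x0; have n0 := ip_gt0 br x0; exists (sqrtC '[x, x])^-1.
  by rewrite invr_eq0 sqrtC_eq0 lt0r_neq0.
rewrite ipZl ipZr mulrA conj_Creal; last first.
  by rewrite rpredV ger0_real// sqrtC_ge0 ltW.
by rewrite -expr2 exprVn sqrtCK mulVf// lt0r_neq0.
Qed.

Lemma orthonormal_pair : (exists x : E, x != 0) -> ~ one_dimensional E ->
  exists e f, [/\ '[e, e] = 1, '[f, f] = 1 & '[e, f] = 0].
Proof.
move=> [x x0] dimE; have [c c0] := normalize x0.
set e := c *: x => e1.
have e0 : e != 0 by rewrite scaler_eq0 negb_or c0.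
have [y yP] : exists y, forall k, y <> k *: e.
  apply: contrapT => /forallNP h; apply: dimE; exists e => // y.
  by apply: contrapT => /forallNP ky; exact: (h y).
have f0 : y - '[y, e] *: e != 0 by rewrite subr_eq0; apply/eqP/yP.
have [d d0 f1] := normalize f0.
exists e, (d *: (y - '[y, e] *: e)); split => //.
by rewrite ipZr ipBr ipZr e1 mulr1 ipC subrr mulr0.
Qed.

End OrthonormalPairs.

Section DenseDomain.
Variables (R : realType) (H : completeNormedModType R[i]).
Variables (ip : {dot H for Num.conj}) (D : submodClosed H).

Definition dom_form (x y : dom D) : R[i] := ip (\val x) (\val y).

Let dom_form_bilinear : bilinear_for
  (GRing.Scale.Law.clone _ _ ( *%R ) _)
  (GRing.Scale.Law.clone _ _ (Num.conj \; *%R ) _)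
  dom_form.
Proof.
have valE (c : R[i]) (x y : dom D) : \val (c *: x + y) = c *: \val x + \val y.
  exact: linearP.
split=> [z c x y|z c x y]; rewrite /dom_form valE.
  by rewrite ipDl ipZl.
by rewrite ipDr ipZr.
Qed.

HB.instance Definition _ :=
  bilinear_isBilinear.Build _ _ _ _ _ _ dom_form dom_form_bilinear.

Let dom_form_hermitian x y : dom_form x y = (-1) ^+ false * (dom_form y x)^*.
Proof. exact: hermC. Qed.

HB.instance Definition _ :=
  isHermitianSesquilinear.Build _ _ _ _ dom_form dom_form_hermitian.

Let dom_form_gt0 x : x != 0 -> 0 < dom_form x x.
Proof.
by move=> x0; apply: ip_gt0; apply: contraNneq x0 => x0; apply/eqP/val_inj.
Qed.

HB.instance Definition _ := isDotProduct.Build _ _ dom_form dom_form_gt0.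

Local Notation form := dom_form.

Hypothesis ip_norm : forall x : H, `|x| ^+ 2 = ip x x.
Hypothesis D_dense : dense [set x : H | x \in D].

(** By the Pythagorean theorem no point of [D] lies in the open ball around [z]
    of radius [`|z|] when [z] is orthogonal to [D]. *)
Lemma orthogonal_dense0 z : (forall x : dom D, ip (\val x) z = 0) -> z = 0.
Proof.
move=> zD; apply/eqP; apply: contraT => z0.
have z_gt0 : 0 < `|z| by rewrite normr_gt0.
have [||d []] := D_dense (O := ball z `|z|); [|exact: ball_open|].
  by exists z; exact: ballxx.
rewrite -ball_normE/= => zd Dd; exfalso.
have dz : ip z d = 0 by rewrite -ipC (zD (Dom Dd)) conjC0.
have : `|z - d| ^+ 2 < `|z| ^+ 2 by rewrite ltr_pXn2r// nnegrE.
have d_ge0 : 0 <= ip d d by rewrite -ip_norm exprn_ge0.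
by rewrite !ip_norm hnormBd// gtrDl => /lt_le_trans/(_ d_ge0); rewrite ltxx.
Qed.

Lemma is_adjoint_value_uniq (A : dom D -> dom D) y z z' :
  is_adjoint_value ip A y z -> is_adjoint_value ip A y z' -> z = z'.
Proof.
move=> Az Az'; apply/subr0_eq/orthogonal_dense0 => x.
by rewrite ipBr -Az -Az' subrr.
Qed.

Lemma Lplus_adjoint_of (A : dom D -> dom D) :
  Lplus ip A -> adjoint_of form A (involution ip A).
Proof.
move=> [_ AL] x y; have [[z Az] AD] := AL y.
rewrite -[RHS]/(ip (\val x) (\val (involution ip A y))) /involution.
rewrite insubdK// /adjoint.
by case: xgetP => [t _ At|/(_ z)[//]]; exact: At.
Qed.

(** The adjoint with respect to [D] is the Hilbert space adjoint, whose values
    are unique by density. *)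
Lemma adjointable_Lplus (A : dom D -> dom D) : adjointable form A -> Lplus ip A.
Proof.
move=> hA; split=> [c x y|y].
  by rewrite (adjointableD _ _ hA) (adjointableZ _ _ hA).
have Ay : is_adjoint_value ip A (\val y) (\val (adj form A y)).
  by move=> x; exact: (adjP hA).
split; first by eexists; exact: Ay.
suff -> : adjoint ip A (\val y) = \val (adj form A y) by exact: valP.
rewrite /adjoint; case: xgetP => [z _ Az|/(_ _ Ay)//].
exact: is_adjoint_value_uniq Az Ay.
Qed.

Lemma LplusE (A : dom D -> dom D) : Lplus ip A <-> adjointable form A.
Proof.
split; last exact: adjointable_Lplus.
by move=> /Lplus_adjoint_of AB; eexists; exact: AB.
Qed.

Lemma involutionE (A : dom D -> dom D) :
  Lplus ip A -> involution ip A = adj form A.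
Proof. by move=> /Lplus_adjoint_of/adjE. Qed.

Lemma tauE b (A : dom D -> dom D) : Lplus ip A -> tau ip b A = star_if form b A.
Proof. by case: b => //= /involutionE. Qed.

(** A line is closed: the component of [h] orthogonal to it is orthogonal to
    [D]. *)
Lemma one_dimensional_dense : one_dimensional (dom D) -> one_dimensional H.
Proof.
move=> [e e0 De].
have v0 : \val e != 0 by apply: contraNneq e0 => v0; apply/eqP/val_inj.
exists (\val e) => // h; exists (ip h (\val e) / ip (\val e) (\val e)).
apply/subr0_eq/orthogonal_dense0 => x; have [c ->] := De x.
have -> : \val (c *: e) = c *: \val e by exact: linearZ.
rewrite ipZl ipBr ipZr rmorphM fmorphV/= !ipC divfK ?subrr ?mulr0//.
exact: ip_neq0.
Qed.

(** Two rank-one operators around [T] produce [rank1 u v] with the coefficient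
    [<T x, T x>]. *)
Lemma star_ideal_rank1 (I : set (dom D -> dom D)) (T : dom D -> dom D) :
  star_ideal ip I -> I T -> T != 0 -> rank1_ideal form I.
Proof.
move=> II IT T0; have [x Tx] : exists x, T x != 0.
  apply: contrapT => /forallNP h; case/negP: T0; apply/eqP/funext => x.
  by apply/eqP/negPn/negP/h.
split.
- by move=> A /(ideal_sub II)/LplusE.
- exact: (Defs.idealD II).
- by move=> A B /LplusE; exact: (idealMl II).
- by move=> A B IA /LplusE LB; exact: (Defs.idealMr II IA LB).
- move=> A IA; rewrite -involutionE; last exact: (ideal_sub II).
  exact: (ideal_plus II).
move=> u v.
have aT : adjointable form T by apply/LplusE/(ideal_sub II).
have -> : rank1 form u v =
    (form (T x) (T x))^-1 *: (rank1 form u (T x) \o T \o rank1 form x v).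
  by rewrite rank1_sandwich// scalerA mulVf ?scale1r// ip_neq0.
apply: (idealZ II).
apply: (Defs.idealMr II); last exact/LplusE/rank1_adjointable.
by apply: (idealMl II) => //; exact/LplusE/rank1_adjointable.
Qed.

End DenseDomain.

Lemma op_prod_word (R : realType) (H : completeNormedModType R[i])
    (D : submodClosed H) n (f : nat -> dom D -> dom D) :
  op_prod (fun j : 'I_n => f j) = word n f.
Proof.
rewrite /op_prod; elim: n f => [|n IH] f; first by rewrite big_ord0.
by rewrite big_ord_recl wordS -IH.
Qed.

Theorem proposition3p7 (R : realType) (H : completeNormedModType R[i])
    (ip : {dot H for Num.conj}) (ip_norm : forall x : H, `|x| ^+ 2 = ip x x)
    (dimH : ~ one_dimensional H)
    (D : submodClosed H) (FD : F_domain ip D)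
    (I : set (dom D -> dom D)) (idealI : star_ideal ip I)
    (n : nat) (n_gt1 : (1 < n)%N) (star : 'I_n -> bool)
    (Phi : (dom D -> dom D) -> (dom D -> dom D)) (Phi_bij : set_bij I I Phi)
    (Phi_prod : forall T : 'I_n -> dom D -> dom D, (forall j, I (T j)) ->
      Phi (op_prod (fun j => tau ip (star j) (T j))) =
      op_prod (fun j => tau ip (star j) (Phi (T j)))) :
  (exists j, star j) -> additive_triple_automorphism ip I Phi.
Proof.
move=> [j0 j0P]; have [D_dense _ _] := FD.
(* The zero ideal contains no rank-one operators and is treated apart. *)
have [I0|] := pselect (forall A, I A -> A = 0).
  have IPhi A : I A -> Phi A = 0.
    by move=> IA; apply: I0; have [+ _ _] := Phi_bij; apply.
  split=> // [A B IA IB|A B C IA IB IC].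
    by rewrite !IPhi ?addr0//; exact: (Defs.idealD idealI).
  rewrite (IPhi (A \o _ \o _)) ?(IPhi _ IA) ?(IPhi _ IC)//.
  apply: (Defs.idealMr idealI); last exact: (ideal_sub idealI).
  apply: (Defs.idealMr idealI) => //.
  exact/(ideal_sub idealI)/(ideal_plus idealI).
move=> /existsNP[T /not_implyP[IT /eqP T0]].
pose form := dom_form ip (D := D).
have II : rank1_ideal form I by exact: star_ideal_rank1 IT T0.
have IL A : I A -> Lplus ip A by exact: (ideal_sub idealI).
have IPhi A : I A -> I (Phi A) by have [+ _ _] := Phi_bij; apply.
have [m nE] : exists m, n = m.+2 by exists n.-2; rewrite -subn2 -addn2 subnK.
subst n; pose b j := star (inord j).
have PhiP : word_map form I m.+2 b Phi.
  split=> // S IS; have := Phi_prod (fun j => S j) (fun j => IS j).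
  have tauS (F : (dom D -> dom D) -> dom D -> dom D) :
      (forall A, I A -> I (F A)) ->
      op_prod (fun j => tau ip (star j) (F (S j))) =
      word m.+2 (fun j => star_if form (b j) (F (S j))).
    move=> IF; rewrite -op_prod_word; congr op_prod; apply/funext => j.
    by rewrite /b inord_val tauE//; exact/IL/IF.
  by rewrite (tauS Phi)// (tauS idfun).
have [e [f [e1 f1 ef]]] : exists e f,
    [/\ form e e = 1, form f f = 1 & form e f = 0].
  apply: orthonormal_pair; last by move=> /(one_dimensional_dense ip_norm D_dense).
  have [x Tx] : exists x, T x != 0.
    apply: contrapT => /forallNP h; case/negP: T0; apply/eqP/funext => x.
    by apply/eqP/negPn/negP/h.
  by exists (T x).
split=> // [A B IA IB|A B C IA IB IC].
  exact: (word_map_additive II PhiP e1 f1 ef).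
have [U [V UV]] := word_map_rank1_factor II PhiP e1.
have bP : exists2 j, (j < m.+2)%N & b j.
  by exists j0 => //; rewrite /b inord_val.
rewrite !involutionE; [|exact/IL/IPhi|exact: IL].
exact: (word_map_triple II PhiP e1 UV bP).
Qed.
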